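(* Every Borel data structure is naturally isomorphic to a sub-data structure of $\mathrm{ARRAY}([0,1],\square^*_{\neq})$.
   Context: A Borel space is a measurable space admitting a bi-measurable bijection onto a Borel subset of $[0,1]$. A Borel data structure (BDS) $D$ is a rule mapping every finite set $a$ to a Borel space $D_a$ and every injection $\tau:b\to a$ between finite sets to a measurable map $D[\tau]:D_a\to D_b$, with $D[\mathrm{id}_a]=\mathrm{id}_{D_a}$ and $D[\sigma\circ\tau]=D[\tau]\circ D[\sigma]$ for composable injections. (''Rules'' on all finite sets: NBG with global choice, or inside a fixed Grothendieck universe.) A natural transformation $\eta:D\to E$ of BDS is a rule sending every finite set $a$ to a measurable map $\eta_a:D_a\to E_a$ with $\eta_b\circ D[\tau]=E[\tau]\circ\eta_a$ for every injection $\tau:b\to a$; it is an isomorphism if every $\eta_a$ is bijective, and $D,E$ are (naturally) isomorphic if an isomorphism between them exists. A BDS $D'$ is a sub-data structure of $D$ if for every finite $a$, $D'_a\subseteq D_a$ is a measurable subspace, and $D'[\tau](x)=D[\tau](x)$ for every injection $\tau:b\to a$ and $x\in D'_a$. $a^*_{\neq}$ is the set of all finite-length tuples $(i_1,\dots,i_k)$, $k\ge0$, of pairwise distinct elements of $a$. $\mathrm{ARRAY}([0,1],\square^*_{\neq})$ is the BDS with $D_a=[0,1]^{a^*_{\neq}}$ and $D[\tau](x)=x\circ\vec\tau$, where $\vec\tau(i_1,\dots,i_k)=(\tau(i_1),\dots,\tau(i_k))$. *)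

(* Defs.v *)
From HB Require Import structures.
From mathcomp Require Import all_boot all_order all_algebra.
From mathcomp Require Import all_classical all_reals all_analysis.
From mathcomp Require Import measurable_realfun ring lra.

Set Implicit Arguments.
Unset Strict Implicit.
Unset Printing Implicit Defensive.

Import Order.TTheory GRing.Theory Num.Theory.
Import numFieldNormedType.Exports.

Local Open Scope classical_set_scope.
Local Open Scope ring_scope.

(* [measurableType] is pointed, hence never empty, whereas a Borel space (and a
   component of a Borel data structure) may be empty. *)
Record mspace := MSpace {
  mcarrier :> Type;
  mset : set (set mcarrier);
  mset_sigma : sigma_algebra setT mset }.

Arguments mset {m} _.

Definition mfunction (X Y : mspace) (f : X -> Y) : Prop :=
  forall B : set Y, mset B -> mset (f @^-1` B).

Definition mspace_of d (T : measurableType d) : mspace :=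
  MSpace (sigma_algebra_measurable T).

Definition subspace_mset (X : mspace) (A : set X) : set (set (set_type A)) :=
  preimage_set_system setT (@set_val _ A) (@mset X).

Lemma subspace_mset_sigma (X : mspace) (A : set X) :
  sigma_algebra setT (@subspace_mset X A).
Proof. exact: sigma_algebra_preimage (mset_sigma X). Qed.

Definition msubspace (X : mspace) (A : set X) : mspace :=
  MSpace (@subspace_mset_sigma X A).

Definition power_mset (I : Type) (X : mspace) : set (set (I -> X)) :=
  <<s \bigcup_(i : I) preimage_set_system setT (fun x : I -> X => x i)
        (@mset X) >>.

Lemma power_mset_sigma (I : Type) (X : mspace) :
  sigma_algebra setT (@power_mset I X).
Proof. exact: smallest_sigma_algebra. Qed.

Definition mpower (I : Type) (X : mspace) : mspace :=
  MSpace (@power_mset_sigma I X).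

Definition bimeasurable (X Y : mspace) : Prop :=
  exists (f : X -> Y) (g : Y -> X),
    [/\ cancel f g, cancel g f, mfunction f & mfunction g].

Definition unit_interval (R : realType) : mspace :=
  @msubspace (mspace_of (measurableTypeR R)) [set` `[0%R, 1%R]].

Definition borel_space (R : realType) (X : mspace) : Prop :=
  exists2 B : set (unit_interval R), mset B & bimeasurable X (msubspace B).


Lemma msetT (X : mspace) : mset [set: X].
Proof. by have [h0 hC _] := mset_sigma X; rewrite -(setD0 setT); exact: hC. Qed.

Lemma msetI (X : mspace) (A B : set X) : mset A -> mset B -> mset (A `&` B).
Proof.
have [_ _ _ h] := (sigma_algebraP (fun _ _ => @subsetT _ _)).1 (mset_sigma X).
exact: h.
Qed.

Lemma mfunction_comp (X Y Z : mspace) (g : Y -> Z) (f : X -> Y) :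
  mfunction g -> mfunction f -> mfunction (g \o f).
Proof. by move=> mg mf B /mg /mf. Qed.

Lemma mfunction_set_val (X : mspace) (A : set X) :
  @mfunction (msubspace A) X set_val.
Proof. by move=> B mB; exists B; rewrite // setTI. Qed.

Lemma mfunction_sub (X Y : mspace) (A : set Y) (f : X -> msubspace A) :
  mfunction ((@set_val _ A : msubspace A -> Y) \o f) -> mfunction f.
Proof. by move=> mf _ [B mB <-]; rewrite setTI -comp_preimage; exact: mf. Qed.

Lemma mfunction_proj (I : Type) (X : mspace) (i : I) :
  @mfunction (mpower I X) X (fun x => x i).
Proof.
move=> B mB; apply: sub_sigma_algebra.
by exists i => //; exists B => //; rewrite setTI.
Qed.

Lemma mfunction_power (I : Type) (X Y : mspace) (f : X -> mpower I Y) :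
  (forall i, mfunction (fun x => f x i)) -> mfunction f.
Proof.
move=> mf.
suff : @mset (mpower I Y) `<=` image_set_system setT f (@mset X).
  by move=> h B /h; rewrite /image_set_system /= setTI.
apply: smallest_sub.
  exact: sigma_algebra_image (mset_sigma X).
move=> _ [i _ [B mB <-]]; rewrite /image_set_system /= !setTI.
exact: (mf i B mB).
Qed.

Lemma borel_spaceP (R : realType) (X : mspace) : borel_space R X <->
  exists f : X -> unit_interval R,
    [/\ injective f, mfunction f & forall A, mset A -> mset (f @` A)].
Proof.
split=> [[B mB [f [g [fK gK mf mg]]]]|[f [fI mf fm]]].
  exists (set_val \o f); split.
  - by move=> x y /= /val_inj /(can_inj fK).
  - exact: mfunction_comp (@mfunction_set_val _ B) mf.
  - move=> A /mg [C mC]; rewrite setTI => CA.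
    rewrite (_ : _ @` A = B `&` C); first exact: msetI.
    apply/seteqP; split=> [_ [x Ax <-] /=|y [By Cy]].
      split; first exact: set_valP.
      have : (g @^-1` A) (f x) by rewrite /= fK.
      by rewrite -CA.
    pose z : msubspace B := SigSub (mem_set By).
    have zA : (g @^-1` A) z by rewrite -CA.
    by exists (g z) => //=; rewrite gK.
have mr : mset (range f) by apply: fm; exact: msetT.
exists (range f) => //.
pose g0 (y : msubspace (range f)) : X := sval (cid2 (set_valP y)).
have g0E y : f (g0 y) = set_val y by rewrite /g0; case: cid2.
have fr x : f x \in range f by apply: mem_set; exists x.
pose f0 x : msubspace (range f) := SigSub (fr x).
exists f0, g0; split.
- by move=> x; apply: fI; rewrite g0E.
- by move=> y; apply: val_inj; rewrite /= g0E.
- exact: mfunction_sub.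
- move=> A mA; exists (f @` A); first exact: fm.
  rewrite setTI; apply/seteqP; split=> y /=; rewrite -g0E.
    by move=> [x Ax /fI <-].
  by move=> h; exists (g0 y).
Qed.

Lemma borel_space_sub (R : realType) (X : mspace) (A : set X) :
  mset A -> borel_space R X -> borel_space R (msubspace A).
Proof.
move=> mA /borel_spaceP [f [fI mf fm]]; apply/borel_spaceP.
exists (f \o set_val); split.
- by move=> x y /= /fI /val_inj.
- exact: mfunction_comp mf (@mfunction_set_val _ A).
- move=> _ [B mB <-]; rewrite setTI -image_comp.
  rewrite (_ : set_val @` _ = A `&` B); first exact/fm/msetI.
  apply/seteqP; split=> [_ [x Bx <-]|x [Ax Bx]].
    by split => //; exact: set_valP.
  by exists (SigSub (mem_set Ax)).
Qed.

(* A nonempty measurable space as a library [measurableType]. *)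
Definition pointed_mspace (X : mspace) (x0 : X) : Type := X.

HB.instance Definition _ X x0 := gen_eqMixin (@pointed_mspace X x0).
HB.instance Definition _ X x0 := gen_choiceMixin (@pointed_mspace X x0).
HB.instance Definition _ X x0 := isPointed.Build (@pointed_mspace X x0) x0.

Lemma mset0 (X : mspace) : @mset X set0.
Proof. by have [] := mset_sigma X. Qed.

Lemma msetC (X : mspace) (A : set X) : mset A -> mset (~` A).
Proof. by have [_ h _] := mset_sigma X; move=> /h; rewrite setTD. Qed.

Lemma mset_bigcup (X : mspace) (F : (set X)^nat) :
  (forall n, mset (F n)) -> mset (\bigcup_n F n).
Proof. by have [_ _] := mset_sigma X; apply. Qed.

HB.instance Definition _ X x0 :=
  @isMeasurable.Build default_measure_display (@pointed_mspace X x0)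
    (@mset X) (@mset0 X) (@msetC X) (@mset_bigcup X).

Lemma mfunctionP d (T : measurableType d) (X : mspace) (x0 : X) (f : X -> T) :
  @mfunction X (mspace_of T) f <->
  measurable_fun [set: pointed_mspace x0] f.
Proof.
split=> [mf _ B mB|mf B mB]; first by rewrite setTI; exact: mf.
by rewrite -[_ @^-1` _]setTI; exact: mf measurableT _ mB.
Qed.

Lemma borel_space_retract (R : realType) (X : mspace)
    (f : X -> unit_interval R) (g : unit_interval R -> X) :
  mfunction f -> mfunction g -> cancel f g -> borel_space R X.
Proof.
move=> mf mg fK; apply/borel_spaceP; exists f; split=> // [|A mA].
  exact: can_inj fK.
have z01 : (0 : R) \in [set` `[0%R, 1%R]] by rewrite mem_setE in_itv/= lexx ler01.
pose u0 : unit_interval R := SigSub z01.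
have m1 := (mfunctionP u0 _).1 (mfunction_comp
  (@mfunction_set_val (mspace_of (measurableTypeR R)) [set` `[0%R, 1%R]])
  (mfunction_comp mf mg)).
have m2 := (mfunctionP u0 _).1
  (@mfunction_set_val (mspace_of (measurableTypeR R)) [set` `[0%R, 1%R]]).
have /(_ measurableT [set true] I) := measurable_fun_eqr m1 m2.
rewrite setTI => mE.
rewrite (_ : f @` A = g @^-1` A `&` ((fun x => set_val (f (g x)) == set_val x) @^-1` [set true])).
  by apply: msetI => //; exact: mg.
apply/seteqP; split=> [_ [x Ax <-] /=|y [/= Ay /eqP/val_inj fgy]].
  by rewrite fK eqxx.
by exists (g y).
Qed.


(* Ternary coding of binary sequences, and its inverse read digit by digit. *)
Definition ternary_weight (R : realType) (n : nat) : R := 2 / 3 ^+ n.+1.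

Definition ternary_sum (R : realType) (b : nat -> bool) (n : nat) : R :=
  \sum_(k < n) (if b k then ternary_weight R k else 0).

Definition ternary_code (R : realType) (b : nat -> bool) : R :=
  sups (ternary_sum R b) 0.

Fixpoint ternary_prefix (R : realType) (n : nat) (r : R) : R :=
  if n is m.+1 then
    ternary_prefix m r +
      (if ternary_prefix m r + ternary_weight R m <= r
       then ternary_weight R m else 0)
  else 0.

Definition ternary_digit (R : realType) (n : nat) (r : R) : bool :=
  ternary_prefix n r + ternary_weight R n <= r.

Lemma sups0_ge (R : realType) (u : nat -> R) (M : R) k :
  (forall k, u k <= M) -> u k <= sups u 0.
Proof.
move=> uM; apply: ub_le_sup; last by exists k.
by exists M => _ [n _ <-].
Qed.

Lemma sups0_le (R : realType) (u : nat -> R) (M : R) :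
  (forall k, u k <= M) -> sups u 0 <= M.
Proof.
move=> uM; apply: ge_sup; first by exists (u 0%N); exists 0%N.
by move=> _ [n _ <-].
Qed.

Lemma ternary_weight_gt0 (R : realType) n : 0 < ternary_weight R n.
Proof. by rewrite divr_gt0 ?exprn_gt0. Qed.

Lemma ternary_sumS (R : realType) b n : ternary_sum R b n.+1 =
  ternary_sum R b n + (if b n then ternary_weight R n else 0).
Proof. by rewrite /ternary_sum big_ord_recr. Qed.

Lemma ternary_sum_homo (R : realType) b n k :
  ternary_sum R b n <= ternary_sum R b (n + k).
Proof.
elim: k => [|k ih]; first by rewrite addn0.
rewrite addnS ternary_sumS (le_trans ih)// lerDl.
by case: ifP => // _; exact/ltW/ternary_weight_gt0.
Qed.

Lemma ternary_sum_le (R : realType) b n m :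
  ternary_sum R b m <= ternary_sum R b n + (3 ^+ n)^-1.
Proof.
have H k : ternary_sum R b (n + k) + (3 ^+ (n + k))^-1 <=
    ternary_sum R b n + (3 ^+ n)^-1.
  elim: k => [|k ih]; first by rewrite addn0.
  apply: le_trans ih; rewrite addnS ternary_sumS -addrA lerD2l.
  rewrite /ternary_weight exprS invfM.
  have : 0 < (3 ^+ (n + k))^-1 :> R by rewrite invr_gt0 exprn_gt0.
  by case: ifP => _; lra.
have [mn|/ltnW nm] := leqP m n.
  have := ternary_sum_homo R b m (n - m); rewrite subnKC// => h.
  by rewrite (le_trans h)// lerDl invr_ge0 exprn_ge0.
have := H (m - n)%N; rewrite subnKC//; apply: le_trans.
by rewrite lerDl invr_ge0 exprn_ge0.
Qed.

Lemma ternary_sum_le1 (R : realType) b m : ternary_sum R b m <= 1.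
Proof.
have := ternary_sum_le R b 0 m.
by rewrite /ternary_sum big_ord0 add0r expr0 invr1.
Qed.

Lemma ternary_sum_le_code (R : realType) b n :
  ternary_sum R b n <= ternary_code R b.
Proof. exact: sups0_ge (ternary_sum_le1 R b). Qed.

Lemma ternary_code_le_sum (R : realType) b n :
  ternary_code R b <= ternary_sum R b n + (3 ^+ n)^-1.
Proof. exact/sups0_le/ternary_sum_le. Qed.

Lemma ternary_code_itv (R : realType) b :
  ternary_code R b \in [set` `[0%R, 1%R]].
Proof.
rewrite mem_setE in_itv /= (sups0_le (ternary_sum_le1 R b)) andbT.
by have := ternary_sum_le_code R b 0; rewrite /ternary_sum big_ord0.
Qed.

Lemma ternary_codeK_step (R : realType) b n :
  (ternary_sum R b n + ternary_weight R n <= ternary_code R b) = b n.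
Proof.
have := ternary_sum_le_code R b n.+1.
have := ternary_code_le_sum R b n.+1.
rewrite ternary_sumS; case: (b n) => [_ ->//|+ _].
rewrite addr0 => h; apply/negbTE; rewrite -ltNge; apply: le_lt_trans h _.
by rewrite ltrD2l /ternary_weight ltr_pMl ?invr_gt0 ?exprn_gt0// ltr1n.
Qed.

Lemma ternary_prefixK (R : realType) b n :
  ternary_prefix n (ternary_code R b) = ternary_sum R b n.
Proof.
elim: n => [|n ih] /=; first by rewrite /ternary_sum big_ord0.
by rewrite ih ternary_codeK_step ternary_sumS.
Qed.

Lemma ternary_codeK (R : realType) b n :
  ternary_digit n (ternary_code R b) = b n.
Proof. by rewrite /ternary_digit ternary_prefixK ternary_codeK_step. Qed.

Lemma measurable_ternary_code d (T : measurableType d) (R : realType)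
    (b : T -> nat -> bool) :
  (forall n, measurable_fun setT (fun x => b x n)) ->
  measurable_fun setT (fun x => ternary_code R (b x)).
Proof.
move=> mb; apply: measurable_fun_sups => [x _|m].
  by exists 1 => _ [n _ <-]; exact: ternary_sum_le1.
apply: measurable_sum => k.
exact: measurable_fun_ifT.
Qed.

Lemma measurable_ternary_prefix (R : realType) n :
  measurable_fun setT (@ternary_prefix R n).
Proof.
elim: n => [|n ih] //=.
apply: measurable_funD => //; apply: measurable_fun_ifT => //.
by apply: measurable_fun_ler => //; exact: measurable_funD.
Qed.

Lemma measurable_ternary_digit (R : realType) n :
  measurable_fun setT (@ternary_digit R n).
Proof.
apply: measurable_fun_ler => //.
by apply: measurable_funD => //; exact: measurable_ternary_prefix.
Qed.

(* A point of [0,1]^I is coded by the comparisons of its coordinates with the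
   rational numbers. *)
Definition power_bits (R : realType) (I : countType)
    (x : mpower I (unit_interval R)) (n : nat) : bool :=
  if unpickle n is Some (i, q) then ratr q < set_val (x i) :> R else false.

Definition power_value (R : realType) (I : countType) (b : nat -> bool)
    (i : I) (n : nat) : R :=
  if unpickle n is Some q then
    if b (pickle (i, q)) then Num.max 0 (Num.min 1 (ratr q)) else 0
  else 0.

Lemma power_value_itv (R : realType) (I : countType) b (i : I) n :
  0 <= power_value R b i n <= 1.
Proof.
rewrite /power_value; case: unpickle => [q|]; last by rewrite lexx ler01.
case: ifP => _; last by rewrite lexx ler01.
by rewrite le_max lexx ge_max ler01 ge_min lexx.
Qed.

Lemma power_value_le1 (R : realType) (I : countType) b (i : I) n :
  power_value R b i n <= 1.
Proof. by have /andP[] := power_value_itv R b i n. Qed.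

Lemma power_decode_itv (R : realType) (I : countType) b (i : I) :
  sups (power_value R b i) 0 \in [set` `[0%R, 1%R]].
Proof.
rewrite mem_setE in_itv /= (sups0_le (power_value_le1 R b i)) andbT.
apply: le_trans (sups0_ge 0 (power_value_le1 R b i)).
by have /andP[] := power_value_itv R b i 0.
Qed.

Lemma power_bitsK (R : realType) (I : countType)
    (x : mpower I (unit_interval R)) (i : I) :
  sups (power_value R (power_bits x) i) 0 = set_val (x i).
Proof.
have := set_valP (x i); rewrite /= in_itv /= => /andP[x0 x1].
apply/eqP; rewrite eq_le; apply/andP; split.
  apply: sups0_le => n; rewrite /power_value.
  case: unpickle => [q|//]; rewrite /power_bits pickleK.
  case: ifP => // qx; rewrite ge_max x0 /= ge_min; apply/orP; right.
  exact: ltW.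
rewrite leNgt; apply/negP => sx.
have [q /[!in_itv] /= /andP[sq qx]] := rat_in_itvoo sx.
have := sups0_ge (pickle q) (power_value_le1 R (power_bits x) i).
rewrite {1}/power_value pickleK /power_bits pickleK qx.
rewrite leNgt => /negP; apply; apply: lt_le_trans sq _.
by rewrite le_max le_min lexx andbT (le_trans (ltW qx) x1) orbT.
Qed.

Lemma borel_space_power (R : realType) (I : countType) :
  borel_space R (mpower I (unit_interval R)).
Proof.
have mval := @mfunction_set_val (mspace_of (measurableTypeR R))
  [set` `[0%R, 1%R]].
have z01 : (0 : R) \in [set` `[0%R, 1%R]].
  by rewrite mem_setE in_itv/= lexx ler01.
pose u0 : unit_interval R := SigSub z01.
pose f (x : mpower I (unit_interval R)) : unit_interval R :=
  SigSub (ternary_code_itv R (power_bits x)).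
pose g (u : unit_interval R) : mpower I (unit_interval R) := fun i =>
  SigSub (power_decode_itv R (fun n => ternary_digit n (set_val u)) i).
pose x0 : mpower I (unit_interval R) := fun=> u0.
have mvalP := (mfunctionP (T := measurableTypeR R) u0 set_val).1 mval.
apply: (@borel_space_retract R _ f g).
- apply: mfunction_sub.
  apply: (mfunctionP (T := measurableTypeR R) x0
    (fun x => ternary_code R (power_bits x))).2.
  apply: measurable_ternary_code => n.
  rewrite /power_bits; case: unpickle => [[i q]|//].
  apply: measurable_fun_ltr => //.
  apply: (mfunctionP (T := measurableTypeR R) x0 (fun x => set_val (x i))).1.
  exact: mfunction_comp mval (@mfunction_proj _ _ i).
- apply: mfunction_power => i; apply: mfunction_sub.
  apply: (mfunctionP (T := measurableTypeR R) u0 (fun u =>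
    sups (power_value R (fun n => ternary_digit n (set_val u)) i) 0)).2.
  pose h n (u : pointed_mspace u0) :=
    power_value R (fun m => ternary_digit m (set_val u)) i n.
  apply: (measurable_fun_sups (h := h)) => [u _|n].
    by exists 1 => _ [k _ <-]; exact: power_value_le1.
  rewrite /h /power_value; case: unpickle => [q|//].
  apply: measurable_fun_ifT => //.
  exact: measurableT_comp (@measurable_ternary_digit R _) mvalP.
- move=> x; apply/funext => i; apply: val_inj => /=.
  rewrite -[RHS]power_bitsK; congr (sups (power_value R _ i) 0).
  by apply/funext => n; rewrite ternary_codeK.
Qed.
(* The finite sets are those of the universe of [finType]. *)
Record bds (R : realType) := Bds {
  bds_obj :> finType -> mspace;
  bds_borel : forall a, borel_space R (bds_obj a);
  bds_map : forall (a b : finType) (tau : b -> a),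
    injective tau -> bds_obj a -> bds_obj b;
  bds_map_mfunction : forall (a b : finType) (tau : b -> a)
    (tauI : injective tau), mfunction (bds_map tauI);
  bds_map_id : forall (a : finType) (x : bds_obj a),
    bds_map (@inj_id a) x = x;
  bds_map_comp : forall (a b c : finType) (sigma : b -> a) (tau : c -> b)
      (sigmaI : injective sigma) (tauI : injective tau) (x : bds_obj a),
    bds_map (inj_comp sigmaI tauI) x = bds_map tauI (bds_map sigmaI x) }.

Arguments bds_map {R} D {a b tau} tauI x : rename.

Record nat_trans (R : realType) (D E : bds R) := NatTrans {
  nt_fun : forall a : finType, D a -> E a;
  nt_mfunction : forall a : finType, mfunction (@nt_fun a);
  nt_natural : forall (a b : finType) (tau : b -> a) (tauI : injective tau)
      (x : D a),
    nt_fun (bds_map D tauI x) = bds_map E tauI (nt_fun x) }.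

Arguments nt_fun {R D E} eta a x : rename.

Definition bds_isomorphic (R : realType) (D E : bds R) : Prop :=
  exists eta : nat_trans D E, forall a : finType, bijective (nt_fun eta a).

(* A sub-data structure is determined by its underlying measurable subsets;
   [bds_of_sub] is the resulting Borel data structure. *)
Record sub_bds (R : realType) (D : bds R) := SubBds {
  sub_set : forall a : finType, set (D a);
  sub_mset : forall a : finType, mset (@sub_set a);
  sub_closed : forall (a b : finType) (tau : b -> a) (tauI : injective tau)
      (x : D a),
    sub_set x -> sub_set (bds_map D tauI x) }.

Arguments sub_set {R D} S a _ : rename.
Arguments sub_closed {R D} S {a b tau} tauI {x} _ : rename.

Definition sub_map (R : realType) (D : bds R) (S : sub_bds D) (a b : finType)
    (tau : b -> a) (tauI : injective tau) (x : msubspace (sub_set S a)) :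
    msubspace (sub_set S b) :=
  SigSub (mem_set (sub_closed S tauI (set_valP x))).

Lemma sub_map_mfunction (R : realType) (D : bds R) (S : sub_bds D)
    (a b : finType) (tau : b -> a) (tauI : injective tau) :
  mfunction (@sub_map R D S a b tau tauI).
Proof.
apply: mfunction_sub.
exact: mfunction_comp (bds_map_mfunction  tauI) (@mfunction_set_val _ _).
Qed.

Lemma sub_map_id (R : realType) (D : bds R) (S : sub_bds D) (a : finType)
    (x : msubspace (sub_set S a)) : sub_map (@inj_id a) x = x.
Proof. by apply: val_inj; exact: bds_map_id. Qed.

Lemma sub_map_comp (R : realType) (D : bds R) (S : sub_bds D)
    (a b c : finType) (sigma : b -> a) (tau : c -> b)
    (sigmaI : injective sigma) (tauI : injective tau)
    (x : msubspace (sub_set S a)) :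
  sub_map (inj_comp sigmaI tauI) x = sub_map tauI (sub_map sigmaI x).
Proof. by apply: val_inj; exact: bds_map_comp. Qed.

Definition bds_of_sub (R : realType) (D : bds R) (S : sub_bds D) : bds R :=
  Bds (fun a => borel_space_sub (sub_mset S a) (bds_borel D a))
    (@sub_map_mfunction R D S) (@sub_map_id R D S) (@sub_map_comp R D S).

Definition distinct_tuple (a : finType) : countType := {s : seq a | uniq s}.

Lemma distinct_tuple_map_uniq (a b : finType) (tau : b -> a)
    (tauI : injective tau) (s : distinct_tuple b) :
  uniq (map tau (val s)).
Proof. by rewrite (map_inj_uniq tauI) (valP s). Qed.

Definition distinct_tuple_map (a b : finType) (tau : b -> a)
    (tauI : injective tau) (s : distinct_tuple b) : distinct_tuple a :=
  exist _ (map tau (val s)) (distinct_tuple_map_uniq tauI s).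

Definition array_obj (R : realType) (a : finType) : mspace :=
  mpower (distinct_tuple a) (unit_interval R).

Definition array_map (R : realType) (a b : finType) (tau : b -> a)
    (tauI : injective tau) (x : array_obj R a) : array_obj R b :=
  x \o distinct_tuple_map tauI.

Lemma array_map_mfunction (R : realType) (a b : finType) (tau : b -> a)
    (tauI : injective tau) : mfunction (@array_map R a b tau tauI).
Proof. by apply: mfunction_power => s; exact: mfunction_proj. Qed.

Lemma array_map_id (R : realType) (a : finType) (x : array_obj R a) :
  array_map (@inj_id a) x = x.
Proof.
by apply/funext => s; congr (x _); apply: val_inj; rewrite /= map_id.
Qed.

Lemma array_map_comp (R : realType) (a b c : finType) (sigma : b -> a)
    (tau : c -> b) (sigmaI : injective sigma) (tauI : injective tau)
    (x : array_obj R a) :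
  array_map (inj_comp sigmaI tauI) x = array_map tauI (array_map sigmaI x).
Proof.
by apply/funext => s; congr (x _); apply: val_inj; rewrite /= map_comp.
Qed.

Definition array_bds (R : realType) : bds R :=
  Bds (fun a => borel_space_power R (distinct_tuple a))
    (@array_map_mfunction R) (@array_map_id R) (@array_map_comp R).

(* Main.v *)
Require Import Defs.
From mathcomp Require Import all_boot all_order all_algebra.
From mathcomp Require Import all_classical all_reals all_analysis.
From mathcomp Require Import measurable_realfun.

(** Fix for every [k] a Borel embedding [c_k] of [D_[k]] into the unit interval.
    A tuple [s] of [k] distinct elements of [a] is an injection [[k] -> a], and
    [x : D_a] is sent to the array whose entry at [s] is [c_k (D[s] x)].  The
    entry at an enumeration of [a] already determines [x], and it does so through
    a measurable map; hence the embedding has a measurable left inverse, and its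
    range is the measurable set of the fixed points of the resulting retraction,
    so that the Lusin-Souslin theorem is not needed. *)

(* all_analysis also defines an [mset], for probability measures. *)
Import Defs.

Set Implicit Arguments.
Unset Strict Implicit.
Unset Printing Implicit Defensive.

Local Open Scope classical_set_scope.

(** A measurable injection of [Y] into the unit interval turns [u x = v x] into equality of two
    measurable real functions. *)
Lemma mset_eq (R : realType) (X Y : mspace) (u v : X -> Y) :
  borel_space R Y -> mfunction u -> mfunction v ->
  mset [set x | u x = v x].
Proof.
move=> /borel_spaceP [f [fI mf _]] mu mv.
(* A nonempty coincidence set supplies the base point that [pointed_mspace] requires. *)
have [->|/set0P [x0 _]] := eqVneq [set x | u x = v x] set0.
  exact: mset0.
have mc w : mfunction w ->
    measurable_fun [set: pointed_mspace x0] (fun x => set_val (f (w x)) : R).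
  move=> mw; apply: (mfunctionP (T := measurableTypeR R) x0 _).1.
  exact: mfunction_comp (@mfunction_set_val _ _) (mfunction_comp mf mw).
have /(_ measurableT [set true] I) := measurable_fun_eqr (mc u mu) (mc v mv).
rewrite setTI; congr mset; apply/seteqP; split=> x /=.
  by move=> /eqP /val_inj /fI.
by move=> ->; rewrite eqxx.
Qed.

Lemma mset_range_retract (R : realType) (X Y : mspace) (f : X -> Y)
    (g : Y -> X) :
  borel_space R Y -> mfunction f -> mfunction g -> cancel f g ->
  mset (range f).
Proof.
move=> bY mf mg fK.
have -> : range f = [set y | f (g y) = y].
  apply/seteqP; split=> [_ [x _ <-] /=|y /= <-]; first by rewrite fK.
  by exists (g y).
exact: (mset_eq (v := id)) bY (mfunction_comp mf mg) _.
Qed.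

(** The inverse of [f] on its range is extended by the constant [x0]; this is measurable because [f]
    maps measurable sets to measurable sets. *)
Lemma borel_embedding_retract (R : realType) (X : mspace)
    (f : X -> unit_interval R) (x0 : X) :
  injective f -> mfunction f -> (forall A, mset A -> mset (f @` A)) ->
  exists2 g : unit_interval R -> X, mfunction g & cancel f g.
Proof.
move=> fI mf fm.
pose g u := if pselect (range f u) is left h then sval (cid2 h) else x0.
have fK : cancel f g.
  move=> x; rewrite /g; case: pselect => [h|[]]; last by exists x.
  by case: cid2 => y _ /= /fI.
exists g => // A mA.
have mr : mset (~` range f) by apply/msetC/fm/msetT.
have gN u : (~` range f) u -> g u = x0 by rewrite /g; case: pselect.
(* By De Morgan, this is the union of the image of [A] with, when [x0] lies in [A], the complement
   of the range. *)
have -> : g @^-1` A = ~` (~` (f @` A) `&` ~` (~` range f `&` [set _ | A x0])).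
  rewrite -setCU setCK; apply/seteqP; split=> [u /= Agu|u].
    have [[x _ xu]|nu] := pselect (range f u).
      by left; exists x => //; rewrite -[x]fK xu.
    by right; split => //=; rewrite -(gN u nu).
  by case=> [[x Ax <-]|[/gN /= -> //]] /=; rewrite fK.
apply/msetC/msetI; apply/msetC; first exact: fm.
apply: msetI => //; have [h|h] := pselect (A x0).
  by rewrite (_ : mkset _ = setT); [exact: msetT|apply/seteqP; split].
by rewrite (_ : mkset _ = set0); [exact: mset0|apply/seteqP; split].
Qed.

Lemma bds_map_ext (R : realType) (D : bds R) (a b : finType)
    (tau tau' : b -> a) (tauI : injective tau) (tauI' : injective tau')
    (x : D a) :
  tau =1 tau' -> bds_map D tauI x = bds_map D tauI' x.
Proof.
move=> /funext e; subst tau'.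
by rewrite (Prop_irrelevance tauI tauI').
Qed.

Lemma tnth_inj (T : eqType) (k : nat) (t : k.-tuple T) :
  uniq t -> injective (tnth t).
Proof. by move=> /tuple_uniqP. Qed.

Section Embedding.
Variables (R : realType) (D : bds R).

(** One choice per length, independent of the ambient set [a]: naturality of [embed] rests on
    this. *)
Definition code_spec (k : nat) := cid ((borel_spaceP R _).1 (bds_borel D 'I_k)).

Definition code (k : nat) : D 'I_k -> unit_interval R := sval (code_spec k).

Lemma code_inj k : injective (@code k).
Proof. by rewrite /code; case: code_spec => f []. Qed.

Lemma mfunction_code k : mfunction (@code k).
Proof. by rewrite /code; case: code_spec => f []. Qed.

Lemma mset_image_code k (A : set (D 'I_k)) : mset A -> mset (@code k @` A).
Proof. by rewrite /code; case: code_spec => f [] /= _ _; exact. Qed.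

Definition embed (a : finType) (x : D a) : array_bds R a := fun s =>
  code (bds_map D (tnth_inj (t := in_tuple (val s)) (valP s)) x).

(* Stated for all [k] because [size (map tau s)] and [size s] are not
   convertible. *)
Lemma embedE (a : finType) (x : D a) (s : distinct_tuple a) (k : nat)
    (t : k.-tuple a) (tI : injective (tnth t)) :
  val s = t :> seq a -> embed x s = code (bds_map D tI x).
Proof.
case: s => s us /= st; move: tI; case: t st => t kt /= st; subst t.
have ek : size s = k by apply/eqP.
subst k => tI; rewrite /embed /=; congr (code _).
(* The index [i] provides the default [d], through which both tuples become [nth] of the same
   sequence. *)
by apply: bds_map_ext => i; have d := tnth (in_tuple s) i; rewrite !(tnth_nth d).
Qed.

Lemma mfunction_embed (a : finType) : mfunction (@embed a).
Proof.
apply: mfunction_power => s.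
exact: mfunction_comp (@mfunction_code _) (bds_map_mfunction _).
Qed.

(** Functoriality of [D]: the injection given by [map tau s] is [tau] after the one given by [s],
    and both tuples have the same length, hence the same code. *)
Lemma embed_natural (a b : finType) (tau : b -> a) (tauI : injective tau)
    (x : D a) :
  embed (bds_map D tauI x) = bds_map (array_bds R) tauI (embed x).
Proof.
apply/funext => s /=; rewrite /array_map /=.
pose t := map_tuple tau (in_tuple (val s)).
have tI : injective (tnth t) by apply: tnth_inj; exact: distinct_tuple_map_uniq.
rewrite (embedE _ (t := t) tI)// /embed -bds_map_comp; congr (code _).
by apply: bds_map_ext => i; rewrite tnth_map.
Qed.

Lemma embed_retract (a : finType) (x0 : D a) :
  exists2 g : array_bds R a -> D a, mfunction g & cancel (@embed a) g.
Proof.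
pose s : distinct_tuple a := exist _ (enum a) (enum_uniq a).
pose e := tnth (in_tuple (enum a)).
have eI : injective e := tnth_inj (t := in_tuple (enum a)) (enum_uniq a).
have [r mr rK] := borel_embedding_retract (bds_map D eI x0)
  (@code_inj _) (@mfunction_code _) (@mset_image_code _).
have eS i : {j | e j = i}.
  apply: cid; have /tnthP [j ->] : i \in in_tuple (enum a).
    exact: mem_enum.
  by exists j.
pose e' i := sval (eS i).
have e'K : cancel e' e by move=> i; rewrite /e'; case: (eS i).
(* Decode the entry at [enum a], then transport back along [e']; on the image of [embed] this undoes
   [e], since [e \o e'] is the identity. *)
exists (fun y => bds_map D (can_inj e'K) (r (y s))) => [|x].
  apply: mfunction_comp (bds_map_mfunction _) _.
  exact: mfunction_comp mr (@mfunction_proj _ _ s).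
rewrite (embedE x (t := in_tuple (enum a)) eI)// rK -bds_map_comp.
by rewrite (bds_map_ext _ (@inj_id a) x e'K) bds_map_id.
Qed.

Lemma embed_inj (a : finType) : injective (@embed a).
Proof. by move=> x; have [g _ gK] := embed_retract x; exact: can_inj gK x. Qed.

Lemma mset_range_embed (a : finType) : mset (range (@embed a)).
Proof.
(* [D a] may be empty, and then there is no base point for [embed_retract]. *)
have [->|/set0P [_ [x0 _ _]]] := eqVneq (range (@embed a)) set0.
  exact: mset0.
have [g mg gK] := embed_retract x0.
exact: mset_range_retract (bds_borel _ a) (@mfunction_embed a) mg gK.
Qed.

Lemma range_embed_closed (a b : finType) (tau : b -> a)
    (tauI : injective tau) (y : array_bds R a) :
  range (@embed a) y -> range (@embed b) (bds_map (array_bds R) tauI y).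
Proof. by move=> [x _ <-]; exists (bds_map D tauI x); rewrite ?embed_natural. Qed.

Definition embed_image : sub_bds (array_bds R) :=
  SubBds mset_range_embed range_embed_closed.

Definition embed_corestr (a : finType) (x : D a) : bds_of_sub embed_image a :=
  SigSub (mem_set (imageT (@embed a) x)).

Lemma mfunction_embed_corestr (a : finType) : mfunction (@embed_corestr a).
Proof. by apply: mfunction_sub; exact: mfunction_embed. Qed.

Lemma embed_corestr_natural (a b : finType) (tau : b -> a)
    (tauI : injective tau) (x : D a) :
  embed_corestr (bds_map D tauI x) =
  bds_map (bds_of_sub embed_image) tauI (embed_corestr x).
Proof. by apply: val_inj; exact: embed_natural. Qed.

Lemma embed_corestr_bij (a : finType) : bijective (@embed_corestr a).
Proof.
pose g (y : bds_of_sub embed_image a) : D a := sval (cid2 (set_valP y)).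
have gE y : embed (g y) = set_val y by rewrite /g; case: cid2.
exists g => [x|y]; first by apply: embed_inj; rewrite gE.
by apply: val_inj; exact: gE.
Qed.

End Embedding.

Theorem theorem7 (R : realType) (D : bds R) :
  exists S : sub_bds (array_bds R), bds_isomorphic D (bds_of_sub S).
Proof.
exists (embed_image D).
exists (NatTrans (@mfunction_embed_corestr R D) (@embed_corestr_natural R D)).
exact: embed_corestr_bij.
Qed.
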